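(* For the trivariate second-order Eulerian polynomials $C_n(x,y,z)$ and $n\ge1$, $$C_{n+1}(x,y,z)=\sum_{T\in\mathrm{SYT}(n;3)}\left(\prod_{i=1}^n\sigma_i(T)\right)c_1^{w_1(T)}c_2^{w_2(T)}6^{w_3(T)}(xyz)^{n+1-\ell(\lambda(T))},$$ where $c_1=xy+yz+xz$ and $c_2=2x+2y+2z$.
   Context: A Stirling permutation of order $n$ is a permutation $\sigma=\sigma_1\cdots\sigma_{2n}$ of the multiset $\{1^2,2^2,\dots,n^2\}$ such that for each $i$ all entries between the two occurrences of $i$ are at least $i$; $\mathcal Q_n$ is the set of these. With $\sigma_0=\sigma_{2n+1}=0$, let $\mathrm{des}(\sigma)=\#\{i\in[2n]:\sigma_i>\sigma_{i+1}\}$, $\mathrm{asc}(\sigma)=\#\{i\in\{0,\dots,2n-1\}:\sigma_i<\sigma_{i+1}\}$, $\mathrm{plat}(\sigma)=\#\{i\in[2n-1]:\sigma_i=\sigma_{i+1}\}$. Then $C_n(x,y,z)=\sum_{\sigma\in\mathcal Q_n}x^{\mathrm{asc}(\sigma)}y^{\mathrm{des}(\sigma)}z^{\mathrm{plat}(\sigma)}$. A standard Young tableau of size $n$ is a filling of the Ferrers diagram of a partition $\lambda\vdash n$ (French convention: left-justified rows numbered from bottom to top, $\lambda_i$ boxes in row $i$) with $1,\dots,n$, each used exactly once, increasing from left to right in rows and from bottom to top in columns; $\mathrm{SYT}(n)$ is the set of all of them, and $\mathrm{SYT}(n;k)$ is the subset of those with at most $k$ columns. For $T\in\mathrm{SYT}(n)$,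 $\ell(\lambda(T))$ is the number of rows of $T$, $w_i(T)$ is the number of rows of $T$ with exactly $i$ boxes, $T_i$ is the tableau obtained from $T$ by deleting the entries $i+1,\dots,n$, and $\mathrm{col}_k(T_i)$ is the number of boxes in the $k$-th column of $T_i$. The box sorting index of $i$ is $$\sigma_i(T)=\begin{cases} i-\mathrm{col}_1(T_i)+1, & \text{if } i \text{ is in the first column of } T,\\ \mathrm{col}_k(T_i)-\mathrm{col}_{k+1}(T_i)+1, & \text{if } i \text{ is in the } (k+1)\text{-th column of } T,\ k\ge1.\end{cases}$$ *)

(* Defs.v *)
From HB Require Import structures.
From mathcomp Require Import all_boot all_order all_algebra.
From mathcomp Require Import mpoly.

Set Implicit Arguments.
Unset Strict Implicit.
Unset Printing Implicit Defensive.

Import GRing.Theory.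

(* A word sigma_1 ... sigma_m is a [seq nat].  Since [nth] is taken with
   default 0, this realizes the convention sigma_0 = sigma_(m+1) = 0. *)
Definition letter (s : seq nat) (i : nat) : nat := nth 0 (0 :: s) i.

Definition asc (s : seq nat) : nat :=
  \sum_(0 <= i < size s) (letter s i < letter s i.+1).

Definition des (s : seq nat) : nat :=
  \sum_(1 <= i < (size s).+1) (letter s i > letter s i.+1).

Definition plat (s : seq nat) : nat :=
  \sum_(1 <= i < size s) (letter s i == letter s i.+1).

(* The multiset {1^2, 2^2, ..., n^2}. *)
Definition double_iota (n : nat) : seq nat :=
  flatten [seq [:: i; i] | i <- iota 1 n].

(* Meant for words in which every letter occurs exactly twice: positions
   a < c with equal letters are then the two occurrences of that letter. *)
Definition stirling_word (s : seq nat) : bool :=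
  [forall a : 'I_(size s), forall b : 'I_(size s), forall c : 'I_(size s),
    [&& a < b, b < c & nth 0 s a == nth 0 s c] ==> (nth 0 s a <= nth 0 s b)].

(* [permutations] lists each rearrangement of the multiset exactly once. *)
Definition stirling_perms (n : nat) : seq (seq nat) :=
  [seq s <- permutations (double_iota n) | stirling_word s].

Definition px : {mpoly int[3]} := ('X_(inord 0))%R.
Definition py : {mpoly int[3]} := ('X_(inord 1))%R.
Definition pz : {mpoly int[3]} := ('X_(inord 2))%R.

Definition eulerian2 (n : nat) : {mpoly int[3]} :=
  (\sum_(s <- stirling_perms n) px ^+ asc s * py ^+ des s * pz ^+ plat s)%R.

(* A tableau is the list of its rows from bottom to top, each row being read
   from left to right.  Columns are numbered from 1. *)
Definition is_part (sh : seq nat) : bool := sorted geq sh && (0 \notin sh).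

(* The rows reaching column [k] form an initial segment of the rows when the
   shape is a partition, so this is the [k]-th column from bottom to top. *)
Definition column (k : nat) (t : seq (seq nat)) : seq nat :=
  [seq nth 0 row k.-1 | row <- t & k <= size row].

Definition is_syt (n : nat) (t : seq (seq nat)) : bool :=
  [&& is_part (shape t),
      perm_eq (flatten t) (iota 1 n),
      all (sorted ltn) t
    & all (fun k => sorted ltn (column k t)) (iota 1 n)].

(* A standard Young tableau of size [n] has at most [n] rows, each with at most
   [n] entries, which are at most [n]: the bounds in the type below exclude no
   tableau and only serve to make it finite. *)
Definition tableau (n : nat) : finType := n.-bseq (n.-bseq 'I_n.+1).

Definition rows (n : nat) (T : tableau n) : seq (seq nat) :=
  [seq [seq val e | e <- val row] | row <- val T].

Definition SYT (n : nat) : {set tableau n} :=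
  [set T | is_syt n (rows T)].

(* The number of columns of a tableau is the length of its bottom row. *)
Definition SYT_cols (n k : nat) : {set tableau n} :=
  [set T in SYT n | head 0 (shape (rows T)) <= k].

Definition nrows (t : seq (seq nat)) : nat := size t.

Definition nrows_of_size (i : nat) (t : seq (seq nat)) : nat :=
  count_mem i (shape t).

Definition restrict (i : nat) (t : seq (seq nat)) : seq (seq nat) :=
  [seq row <- [seq [seq e <- row | e <= i] | row <- t] | row != [::]].

Definition col (k : nat) (t : seq (seq nat)) : nat := size (column k t).

Definition col_index (i : nat) (t : seq (seq nat)) : nat :=
  head 0 [seq (index i row).+1 | row <- t & i \in row].

(* On a standard Young tableau containing [i] no subtraction is truncated,
   since col_1(T_i) <= i and col_(k+1)(T_i) <= col_k(T_i). *)
Definition box_sorting_index (i : nat) (t : seq (seq nat)) : nat :=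
  let ti := restrict i t in
  let j := col_index i t in
  if j == 1 then i - col 1 ti + 1 else col j.-1 ti - col j ti + 1.

(* Main.v *)
Require Import Defs.
From mathcomp Require Import all_boot all_order all_algebra.
From mathcomp Require Import mpoly zify ring.
Import GRing.Theory.
Local Open Scope ring_scope.

(** Both sides are the n-th iterate, started at e3 = x y z, of the derivation
    D = x y z (d/dx + d/dy + d/dz), the derivation that sends each of the three
    variables to x y z.

    On the side of permutations, pad a word of order n with a 0 at both ends and
    give each of its 2n+1 gaps the variable x, y or z according as it is an
    ascent, a descent or a plateau; the weight of the word is the product of its
    gaps.  In a Stirling permutation of order n+1 the two letters n+1 are
    adjacent, so that it arises in exactly one way by inserting them into a gap
    of a Stirling permutation of order n ([perm_stirling_permsS]).  The insertion
    replaces that gap by an ascent, a plateau and a descent, that is, its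
    variable by x y z, and D does the same to one factor after another.  Hence
    C_(n+1) = D C_n for n >= 1, and C_1 = e3 ([eulerian2E]).

    On the side of tableaux, D acts on e3 and on the coefficients
    c1 = xy + yz + xz and c2 = 2x + 2y + 2z by
      D e3 = e3 c1,   D c1 = e3 c2,   D c2 = 6 e3,   D 6 = 0.
    Let T have l rows, w1 of them of size 1, w2 of size 2 and w3 of size 3, and
    differentiate c1^w1 c2^w2 6^w3 e3^(n+1-l).  Differentiating e3 adds a row of
    size 1, with coefficient n+1-l; differentiating c1 (c2) turns a row of size 1
    into one of size 2 (2 into 3), with coefficient w1 (w2).  These are the ways
    to add a box n+1 to T within three columns, since in each column there is at
    most one place for it, and the coefficients are the box sorting indices of
    n+1 in the three results: in column 1 it is (n+1) - (l+1) + 1 = n+1-l, and in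
    column k+1 it is w_k, because col_k - col_(k+1) was the number w_k of rows of
    size k before the box was added.  So D maps the term
    of T to the sum of the terms of the tableaux that T grows into
    ([D_tableau_term]), and each tableau of size n+1 grows from exactly one
    tableau of size n ([syt_last], [uniq_tableaux3]). *)

(** * Sequences *)

Lemma mem_split (T : eqType) (x : T) (s : seq T) : x \in s ->
  exists s1 s2, s = s1 ++ x :: s2.
Proof. by case/path.splitPr => s1 s2; exists s1, s2. Qed.

(** A retraction [g] that recovers the pair of arguments from the value of [f] shows
    that [f] takes no value twice; below, [g] removes the largest entry of an object
    and records where that entry was. *)
Lemma allpairs_uniq_retract (S T R : eqType) (f : S -> T -> R) (g : R -> S * T)
    (s : seq S) (t : S -> seq T) :
  uniq s -> {in s, forall x, uniq (t x)} ->
  {in s, forall x, {in t x, forall y, g (f x y) = (x, y)}} ->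
  uniq [seq f x y | x <- s, y <- t x].
Proof.
move=> s_uniq t_uniq gK; apply: allpairs_uniq_dep => // p q.
move=> /allpairsPdep[x [y [xs yt ->]]] /allpairsPdep[x' [y' [xs' yt' ->]]] /=.
by move/(congr1 g); rewrite !gK // => -[-> ->].
Qed.

Lemma iota1S n : iota 1 n.+1 = iota 1 n ++ [:: n.+1].
Proof. by rewrite -(addn1 n) iotaD add1n addn1. Qed.

Lemma sorted_rcons_ltn (s : seq nat) m : {in s, forall x, x < m}%N ->
  sorted ltn s -> sorted ltn (rcons s m).
Proof.
case: s => //= x s lt_m; rewrite rcons_path => ->.
by rewrite /= lt_m // mem_last.
Qed.

(** * The derivation *)

Definition e3 : {mpoly int[3]} := px * py * pz.
Definition c1 : {mpoly int[3]} := px * py + py * pz + px * pz.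
Definition c2 : {mpoly int[3]} := 2%:R * px + 2%:R * py + 2%:R * pz.

Definition D (p : {mpoly int[3]}) : {mpoly int[3]} :=
  e3 * \sum_(i < 3) p^`M(i).

Lemma D0 : D 0 = 0.
Proof. by rewrite /D big1 ?mulr0 // => i _; rewrite mderiv0. Qed.

Lemma DD p q : D (p + q) = D p + D q.
Proof.
rewrite /D -mulrDr -big_split /=; congr (_ * _).
by apply: eq_bigr => i _; rewrite mderivD.
Qed.

Lemma DM p q : D (p * q) = D p * q + p * D q.
Proof.
rewrite /D (eq_bigr (fun i => p^`M(i) * q + p * q^`M(i))); last first.
  by move=> i _; rewrite mderivM.
by rewrite big_split /= -mulr_suml -mulr_sumr; ring.
Qed.

Lemma D_nat k : D k%:R = 0.
Proof.
rewrite /D big1 ?mulr0 // => i _.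
by rewrite -(mpolyC_nat 3 _ k) mderivC.
Qed.

Lemma D_exp p k : D (p ^+ k) = k%:R * p ^+ k.-1 * D p.
Proof.
elim: k => [|k IH]; first by rewrite expr0 (D_nat 1) !mul0r.
rewrite exprS DM IH /=; case: k {IH} => [|k] /=; first by rewrite expr0; ring.
by rewrite exprS -(natr1 k.+1); ring.
Qed.

Lemma D_var (j : 'I_3) : D 'X_j = e3.
Proof.
rewrite /D (bigD1 j) //= big1 => [|i ij].
  have -> : ('X_j)^`M(j) = 1 :> {mpoly int[3]}.
    rewrite mderivX mnm1E eqxx scale1r -mpolyX0; congr 'X_[_].
    by apply/mnmP => k; rewrite mnmBE subnn mnm0E.
  by rewrite addr0 mulr1.
by rewrite mderivX mnm1E eq_sym (negbTE ij) scale0r.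
Qed.

Lemma D_sum (I : Type) (r : seq I) (F : I -> {mpoly int[3]}) :
  D (\sum_(i <- r) F i) = \sum_(i <- r) D (F i).
Proof. exact: (big_morph D DD D0). Qed.

Lemma D_e3 : D e3 = e3 * c1.
Proof. by rewrite {1}/e3 !DM !D_var /c1; ring. Qed.

Lemma D_c1 : D c1 = e3 * c2.
Proof. by rewrite {1}/c1 !DD !DM !D_var /c2; ring. Qed.

Lemma D_c2 : D c2 = e3 * 6%:R.
Proof. by rewrite {1}/c2 !DD !DM !D_nat !D_var; ring. Qed.

(** Leibniz rule, for factors that D maps to [e3]: the i-th summand is the product
    with its i-th factor replaced by [e3]. *)
Lemma D_prod_vars (l : seq {mpoly int[3]}) :
  {in l, forall v, D v = e3} ->
  D (\prod_(v <- l) v) =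
  \sum_(0 <= i < size l)
    (\prod_(v <- take i l) v) * e3 * \prod_(v <- drop i.+1 l) v.
Proof.
elim: l => [|v l IH] Dl; first by rewrite big_nil big_geq //= (D_nat 1).
rewrite big_cons DM big_nat_recl //= Dl ?mem_head // big_nil mul1r drop0.
rewrite IH => [|w wl]; last by rewrite Dl // inE wl orbT.
by rewrite mulr_sumr; congr (_ + _); apply: eq_bigr => i _; rewrite big_cons !mulrA.
Qed.

(** * Stirling permutations *)

Definition step (a b : nat) : {mpoly int[3]} :=
  if (a < b)%N then px else if (b < a)%N then py else pz.

(** The 2n+1 gaps of a word of length 2n, including those next to the two
    outer zeros. *)
Definition gaps (s : seq nat) : seq {mpoly int[3]} :=
  pairmap step 0%N (rcons s 0%N).

Definition weight (s : seq nat) : {mpoly int[3]} := \prod_(v <- gaps s) v.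

Lemma D_step a b : D (step a b) = e3.
Proof. by rewrite /step; case: ifP => _; [|case: ifP => _]; exact: D_var. Qed.

Lemma size_gaps s : size (gaps s) = (size s).+1.
Proof. by rewrite size_pairmap size_rcons. Qed.

Lemma D_weight s :
  D (weight s) =
  \sum_(0 <= i < (size s).+1)
    (\prod_(v <- take i (gaps s)) v) * e3 * \prod_(v <- drop i.+1 (gaps s)) v.
Proof.
rewrite /weight D_prod_vars ?size_gaps // => v /(nthP 0)[i].
rewrite size_gaps => lt_i <-; rewrite (nth_pairmap 0%N) ?size_rcons //.
exact: D_step.
Qed.

(** The two outer gaps of a nonempty word of positive letters are an ascent and a
    descent, so that summing over all gaps adds nothing to the ranges used by [asc],
    [des] and [plat].  The empty word is excluded because its only gap is a plateau
    that [plat] does not count. *)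
Lemma weightE (s : seq nat) : s != [::] -> 0%N \notin s ->
  weight s = px ^+ asc s * py ^+ des s * pz ^+ plat s.
Proof.
move=> s_neq0 s_pos.
have letterS i : nth 0%N (rcons s 0%N) i = letter s i.+1.
  rewrite nth_rcons /letter /=; case: ltngtP => // [lt_si|->].
    by rewrite nth_default // ltnW.
  by rewrite nth_default.
have letter_pos i : (0 < i < (size s).+1)%N -> (0 < letter s i)%N.
  case: i => //= i; rewrite ltnS => lt_i; rewrite lt0n.
  by apply: contraNneq s_pos => <-; apply: mem_nth.
have letter_end : letter s (size s).+1 = 0%N by rewrite /letter /= nth_default.
have s_size : (0 < size s)%N by rewrite lt0n size_eq0.
have stepE a b : step a b = px ^+ (a < b)%N * py ^+ (b < a)%N * pz ^+ (a == b).
  by rewrite /step; case: ltngtP => _; rewrite !expr0 expr1 ?mulr1 ?mul1r.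
rewrite /weight (big_nth 0) size_gaps.
rewrite (eq_big_nat _ _ (F2 := fun i => px ^+ (letter s i < letter s i.+1)%N *
    py ^+ (letter s i > letter s i.+1)%N * pz ^+ (letter s i == letter s i.+1)));
  last first.
  move=> i /andP[_ lt_i]; rewrite (nth_pairmap 0%N) ?size_rcons // letterS stepE.
  suff -> : nth 0%N (0%N :: rcons s 0%N) i = letter s i by [].
  by case: i {lt_i} => // i; rewrite /= letterS.
rewrite !big_split /= !prodrXr; congr (_ ^+ _ * _ ^+ _ * _ ^+ _).
- by rewrite big_nat_recr //= letter_end ltn0 addn0.
- by rewrite big_ltn.
- rewrite big_ltn // big_nat_recr //= letter_end.
  rewrite eq_sym gtn_eqF ?letter_pos ?s_size // gtn_eqF ?letter_pos ?s_size //=.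
  by rewrite add0n addn0.
Qed.

Definition ins (m i : nat) (s : seq nat) : seq nat :=
  take i s ++ [:: m, m & drop i s].

(** The insertion replaces the gap between two letters a and b by the gaps from a
    to [m], from [m] to [m] and from [m] to b: an ascent, a plateau and a descent, because [m] exceeds all
    other letters and the outer zeros. *)
Lemma weight_ins m i s : (0 < m)%N -> all (gtn m) s -> (i <= size s)%N ->
  weight (ins m i s) =
    (\prod_(v <- take i (gaps s)) v) * e3 * \prod_(v <- drop i.+1 (gaps s)) v.
Proof.
move=> m_gt0 s_lt le_i; rewrite /ins /weight /gaps.
rewrite -{3 4}(cat_take_drop i s) !rcons_cat !pairmap_cat.
set a := last _ _; set P := pairmap _ _ _.
have a_lt : (a < m)%N.
  rewrite /a; apply: (allP (_ : all (gtn m) (0%N :: take i s))); last exact: mem_last.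
  by rewrite /= m_gt0; apply/allP => b /mem_take/(allP s_lt).
have size_P : size P = i by rewrite size_pairmap size_takel.
rewrite take_size_cat // drop_cat size_P ltnNge leqnSn /= subSn // subnn.
rewrite headI /= drop0 big_cat /=.
set b := head _ _; have b_lt : (b < m)%N.
  rewrite /b; case def_d: (drop i s) => [|d ds] //=.
  by apply: (allP s_lt); apply: (@mem_drop i); rewrite def_d mem_head.
rewrite !big_cons /step a_lt ltnn (ltnNge m b) ltnW // b_lt /= /e3.
by ring.
Qed.

Lemma subseq_tripleP (s : seq nat) x y z :
  reflect (exists a b c, [/\ (a < b < c)%N, (c < size s)%N,
              nth 0%N s a = x, nth 0%N s b = y & nth 0%N s c = z])
          (subseq [:: x; y; z] s).
Proof.
apply: (iffP idP) => [/subseqP[m _ xyz]|[a [b [c [abc c_s <- <- <-]]]]].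
  have sub_m : subseq (mask m (iota 0 (size s))) (iota 0 (size s)).
    exact: mask_subseq.
  have := subseq_sorted ltn_trans sub_m (iota_ltn_sorted _ _).
  have := mem_subseq sub_m.
  move: xyz; rewrite -[X in mask m X](mkseq_nth 0%N s) -map_mask.
  case: (mask _ _) => [|a [|b [|c [|]]]] //= [-> -> ->] mem_s /and3P[ab bc _].
  exists a, b, c; split; rewrite ?ab //.
  by have := mem_s c; rewrite !inE eqxx !orbT mem_iota => /(_ isT).
rewrite -[X in subseq _ X](mkseq_nth 0%N s).
apply: (@map_subseq _ _ (nth 0%N s) [:: a; b; c]).
apply/subseq_uniqP; first exact: iota_uniq.
apply: (irr_sorted_eq ltn_trans ltnn).
- by case/andP: abc => /= -> ->.
- by apply: sorted_filter (iota_ltn_sorted _ _); apply: ltn_trans.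
move=> i; rewrite mem_filter mem_iota !inE; lia.
Qed.

(** Pattern form of the Stirling condition.  Unlike the indices in the definition,
    subsequences behave well under insertion and deletion of letters. *)
Lemma stirling_wordP (s : seq nat) :
  reflect (forall x y, subseq [:: x; y; x] s -> (x <= y)%N) (stirling_word s).
Proof.
apply: (iffP forallP) => [H x y /subseq_tripleP[a [b [c [abc c_s <- <- eq_ac]]]]|H a].
  case/andP: abc => ab bc.
  have b_s := ltn_trans bc c_s; have a_s := ltn_trans ab b_s.
  have /forallP/(_ (Ordinal b_s))/forallP/(_ (Ordinal c_s)) := H (Ordinal a_s).
  by rewrite /= ab bc eq_ac eqxx.
apply/forallP => b; apply/forallP => c; apply/implyP => /and3P[ab bc /eqP eq_ac].
by apply: H; apply/subseq_tripleP; exists a, b, c; rewrite ab bc -eq_ac.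
Qed.

Lemma double_iotaS n : double_iota n.+1 = double_iota n ++ [:: n.+1; n.+1].
Proof. by rewrite -(addn1 n) /double_iota iotaD map_cat flatten_cat add1n addn1. Qed.

Lemma mem_double_iota n x : x \in double_iota n = (0 < x <= n)%N.
Proof.
apply/flatten_mapP/idP => [[i]|x_n].
  by rewrite mem_iota !inE orbb => i_n /eqP->; lia.
by exists x; rewrite ?mem_head // mem_iota; lia.
Qed.

Lemma mem_stirling_perms n s :
  s \in stirling_perms n = stirling_word s && perm_eq s (double_iota n).
Proof. by rewrite mem_filter mem_permutations. Qed.

Lemma stirling_perms_letters n s : s \in stirling_perms n ->
  s =i double_iota n.
Proof. by rewrite mem_stirling_perms => /andP[_ /perm_mem]. Qed.

Lemma stirling_perms_all n s : s \in stirling_perms n -> all (gtn n.+1) s.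
Proof.
move=> /stirling_perms_letters mem_s; apply/allP => x.
by rewrite mem_s mem_double_iota => /andP[].
Qed.

(** A forbidden pattern x y x with y < x would have to use the new letter [m], but
    [m] is too large to be y, and nothing stands between its two occurrences. *)
Lemma stirling_ins m s1 s2 : all (gtn m) (s1 ++ s2) ->
  stirling_word (s1 ++ s2) -> stirling_word (s1 ++ [:: m, m & s2]).
Proof.
move=> lt_m /stirling_wordP s_st; apply/stirling_wordP => x y sub_xyx.
have not_m z : z \in s1 ++ s2 -> z != m.
  by move/(allP lt_m); rewrite /= ltn_neqAle; case/andP.
have m_s12 : m \notin s1 ++ s2 by apply/negP => /not_m; rewrite eqxx.
have filt t : {subset t <= s1 ++ s2} -> [seq z <- t | z != m] = t.
  by move=> tP; apply/all_filterP/allP => z /tP/not_m.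
have mem_all z : z \in s1 ++ [:: m, m & s2] -> (z <= m)%N.
  rewrite !(mem_cat, inE) => zP; have [->//|z_m] := eqVneq z m.
  by apply/ltnW/(allP lt_m); rewrite mem_cat; move: zP; rewrite (negbTE z_m).
have x_le : (x <= m)%N by apply/mem_all/(mem_subseq sub_xyx)/mem_head.
have [->//|y_m] := eqVneq y m.
have [x_m|x_m] := eqVneq x m; last first.
  apply: s_st; have := subseq_filter [:: x; y; x] (s1 ++ [:: m, m & s2]) (predC1 m).
  rewrite sub_xyx filter_cat /= eqxx !filt /= ?x_m ?y_m //= => z zP;
    by rewrite mem_cat zP ?orbT.
have m1 : m \notin s1 by apply: contra m_s12; rewrite mem_cat => ->.
have m2 : m \notin s2 by apply: contra m_s12; rewrite mem_cat => ->; rewrite orbT.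
(* After the prefix [s1], which lacks [m], the pattern m y m would need [m] in [s2]. *)
exfalso; move: sub_xyx m1 m2; rewrite {}x_m; elim: s1 {filt lt_m s_st not_m m_s12 mem_all}.
  rewrite /= eqxx => + _ /negP; case: ifP => [/eqP y_eq|_]; first by rewrite y_eq eqxx in y_m.
  by move=> sub; apply; apply: (mem_subseq sub); rewrite !inE eqxx orbT.
move=> z s1 IH /=; rewrite inE negb_or; case: (eqVneq m z) => [//|_].
by apply: IH.
Qed.

(** Between the two occurrences of the largest letter only letters at least as large
    are allowed, hence none. *)
Lemma stirling_last n s : s \in stirling_perms n.+1 ->
  exists s1 s2, s = s1 ++ [:: n.+1, n.+1 & s2] /\ s1 ++ s2 \in stirling_perms n.
Proof.
rewrite mem_stirling_perms double_iotaS => /andP[/stirling_wordP s_st s_perm].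
set m := n.+1 in s_perm *.
have m_ds : m \notin double_iota n by rewrite mem_double_iota ltnn andbF.
have [a [b [c def_s]]] : exists a b c, s = a ++ m :: b ++ m :: c.
  have : m \in s by rewrite (perm_mem s_perm) mem_cat mem_head orbT.
  move=> /mem_split[p1 [p2 def_s]].
  have : m \in p1 ++ p2.
    have := permP s_perm (pred1 m); rewrite def_s -has_pred1 has_count !count_cat /= eqxx.
    by lia.
  rewrite mem_cat => /orP[] /mem_split[q1 [q2 def_p]].
    by exists q1, q2, p2; rewrite def_s def_p -catA.
  by exists p1, q1, q2; rewrite def_s def_p.
have perm_abc : perm_eq (a ++ b ++ c) (double_iota n).
  rewrite -(perm_cat2r [:: m; m]) -(permPr s_perm) def_s.
  by apply/permP => P; rewrite !count_cat /= !count_cat /=; lia.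
have def_b : b = [::].
  case: b => [|y b] in def_s perm_abc *; first by [].
  have y_ds : y \in double_iota n by rewrite -(perm_mem perm_abc) !(mem_cat, inE) eqxx orbT.
  have : (m <= y)%N.
    apply: s_st; rewrite def_s -[[:: m; y; m]]cat0s cat_subseq ?sub0seq //= !eqxx.
    by rewrite sub1seq mem_cat mem_head orbT.
  by move: y_ds; rewrite mem_double_iota; lia.
exists a, c; rewrite def_s def_b; split=> //; rewrite mem_stirling_perms.
rewrite def_b in perm_abc def_s; rewrite perm_abc andbT.
apply/stirling_wordP => x y sub_xyx; apply: s_st; apply: subseq_trans sub_xyx _.
by rewrite def_s cat_subseq // (subseq_trans (subseq_cons c m)) // subseq_cons.
Qed.

Lemma perm_stirling_permsS n :
  perm_eq (stirling_perms n.+1)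
    [seq ins n.+1 i s | s <- stirling_perms n, i <- iota 0 (size s).+1].
Proof.
apply: uniq_perm; first by rewrite filter_uniq ?permutations_uniq.
  apply: (allpairs_uniq_retract _ _ _ _
            (fun s => ([seq x <- s | x != n.+1], index n.+1 s))).
  - by rewrite filter_uniq ?permutations_uniq.
  - by move=> s _; apply: iota_uniq.
  move=> s /stirling_perms_all s_lt i; rewrite mem_iota ltnS => /= le_i.
  have s_m (t : seq nat) : {subset t <= s} -> n.+1 \notin t.
    by move=> ts; apply/negP => /ts/(allP s_lt); rewrite /= ltnn.
  have filt t : {subset t <= s} -> [seq x <- t | x != n.+1] = t.
    move=> ts; apply/all_filterP/allP => x xt.
    by apply: contraTneq xt => ->; apply: s_m.
  rewrite /ins filter_cat /= eqxx /= !filt ?cat_take_drop; first last.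
  - by move=> x /mem_take.
  - by move=> x /mem_drop.
  have /negbTE m_take : n.+1 \notin take i s by apply: s_m => x /mem_take.
  rewrite index_cat m_take.
  by rewrite /= eqxx addn0 size_takel.
move=> s; apply/idP/allpairsPdep.
  move=> /stirling_last[s1 [s2 [-> s12]]].
  exists (s1 ++ s2), (size s1); split=> //.
    by rewrite mem_iota size_cat; lia.
  by rewrite /ins take_size_cat // drop_size_cat.
move=> [t [i [t_st _ ->]]]; have t_lt := stirling_perms_all _ _ t_st.
move: t_st t_lt; rewrite !mem_stirling_perms => /andP[t_st t_perm] t_lt.
rewrite stirling_ins ?cat_take_drop //= double_iotaS -(permPr (perm_cat t_perm (perm_refl _))).
by rewrite /ins -{3}(cat_take_drop i t) -catA perm_cat2l (perm_catC [:: _; _]).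
Qed.

Lemma weight_stirling_permsS n :
  \sum_(s <- stirling_perms n.+1) weight s =
  D (\sum_(s <- stirling_perms n) weight s).
Proof.
rewrite (perm_big _ (perm_stirling_permsS n)) big_allpairs_dep D_sum.
apply: eq_big_seq => s /stirling_perms_all s_lt; rewrite D_weight.
rewrite /index_iota subn0; apply: eq_big_seq => i; rewrite mem_iota ltnS => /= le_i.
by rewrite weight_ins.
Qed.

(** The recursion may be started at n = 0: the empty word has a single gap, of weight
    [pz], and D maps [pz] to [e3], which is the polynomial of order 1. *)
Lemma eulerian2E n : eulerian2 n.+1 = iter n D e3.
Proof.
have -> : eulerian2 n.+1 = \sum_(s <- stirling_perms n.+1) weight s.
  apply: eq_big_seq => s /stirling_perms_letters mem_s; rewrite weightE //.
    by apply/eqP => s0; have := mem_s 1%N; rewrite s0 mem_double_iota.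
  by rewrite mem_s mem_double_iota.
elim: n => [|n IH]; last by rewrite weight_stirling_permsS IH.
have stirling0 : stirling_perms 0 = [:: [::]].
  rewrite /stirling_perms (_ : permutations _ = [:: [::]]) //=.
  by have -> : stirling_word [::] by apply/forallP => -[].
by rewrite weight_stirling_permsS stirling0 big_seq1 /weight /gaps /= big_seq1 D_step.
Qed.

(** * Standard Young tableaux and their growth *)

Local Notation row t i := (nth [::] t i).

(** Column strictness, row by row.  Rows past the top of the tableau are read as
    empty, which makes the condition vacuous there; so the top row needs no special
    treatment when a box is added or removed. *)
Definition stacked (t : seq (seq nat)) : Prop := forall i,
  (size (row t i.+1) <= size (row t i))%N /\
  forall j, (j < size (row t i.+1))%N ->
    (nth 0%N (row t i) j < nth 0%N (row t i.+1) j)%N.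

Lemma row_mem (t : seq (seq nat)) i : (0 < size (row t i))%N -> row t i \in t.
Proof.
by case: (ltnP i (size t)) => [/mem_nth//|le_ti]; rewrite nth_default.
Qed.

Lemma mem_flatten_row (t : seq (seq nat)) i j : (j < size (row t i))%N ->
  nth 0%N (row t i) j \in flatten t.
Proof.
move=> lt_j; apply/flattenP; exists (row t i); last exact: mem_nth.
by apply/row_mem/(leq_ltn_trans _ lt_j).
Qed.

Lemma sorted_shapeP (t : seq (seq nat)) :
  reflect (forall i, size (row t i.+1) <= size (row t i))%N (sorted geq (shape t)).
Proof.
apply: (iffP (sortedP 0%N)) => [geq_t i|geq_t i _]; last by rewrite !nth_shape; apply: geq_t.
rewrite -!nth_shape; have [|le_ti] := ltnP i.+1 (size (shape t)); first exact: geq_t.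
by rewrite nth_default.
Qed.

(** The rows that reach column [k] come first, so that selecting them
    does not change their indices. *)
Lemma column_row k (t : seq (seq nat)) i : sorted geq (shape t) -> (0 < k)%N ->
  (i < Defs.col k t)%N = (k <= size (row t i))%N /\
  ((k <= size (row t i))%N -> nth 0%N (column k t) i = nth 0%N (row t i) k.-1).
Proof.
move=> + k_gt0; rewrite /Defs.col; elim: t i => [|r t IH] i.
  by move=> _; rewrite nth_nil /= ltn0 (leqNgt k) k_gt0.
move=> /= t_path; have {}IH j := IH j (path_sorted t_path).
rewrite /column /=; case: ifP => [k_r|/negbT]; last first.
  rewrite -ltnNge => r_k.
  have t0 : (size (row t 0) <= size r)%N by case: t t_path {IH} => //= ? ? /andP[].
  have col0 : size (column k t) = 0%N.
    by apply/eqP; rewrite -leqn0 leqNgt (IH 0%N).1 -ltnNge (leq_ltn_trans t0).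
  have := size0nil col0; rewrite /column => -> /=; rewrite ltn0.
  case: i => [|i] /=; first by rewrite leqNgt r_k.
  by have := (IH i).1; rewrite col0 ltn0 => <-.
case: i => [|i] /=; first by rewrite k_r.
exact: IH.
Qed.

Lemma is_sytP n t :
  reflect [/\ perm_eq (flatten t) (iota 1 n), [::] \notin t,
              all (sorted ltn) t & stacked t]
          (is_syt n t).
Proof.
rewrite /is_syt /is_part; have -> : 0%N \notin shape t = ([::] \notin t).
  congr (~~ _); apply/mapP/idP => [[r rt /esym/size0nil <- //]|nil_t].
  by exists [::].
have row_le i : perm_eq (flatten t) (iota 1 n) -> (size (row t i) <= n)%N.
  move=> /perm_size; rewrite size_iota size_flatten -nth_shape => <-.
  have [lt_i|le_i] := ltnP i (size (shape t)); last by rewrite nth_default.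
  elim: (shape t) i lt_i => //= a s IH [|i] /= lt_i; first exact: leq_addr.
  exact: leq_trans (IH i lt_i) (leq_addl _ _).
apply: (iffP and4P) => [[/andP[shape_t t0] t_perm t_rows /allP t_cols]|].
  split=> // i; split=> [|j lt_j]; first exact/sorted_shapeP.
  have /t_cols/(sortedP 0%N)/(_ i) : j.+1 \in iota 1 n.
    by rewrite mem_iota /=; exact: leq_trans lt_j (row_le _ t_perm).
  have lt_j' : (j < size (row t i))%N by apply: leq_trans lt_j _; apply/sorted_shapeP.
  have [-> ->] := column_row j.+1 _ i.+1 shape_t (ltn0Sn j) => //.
  by have [_ ->] := column_row j.+1 _ i shape_t (ltn0Sn j) => //; apply.
move=> [t_perm t0 t_rows t_st].
have shape_t : sorted geq (shape t) by apply/sorted_shapeP => i; case: (t_st i).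
split=> //; first by rewrite shape_t.
apply/allP => k; rewrite mem_iota => /andP[k_gt0 _]; apply/(sortedP 0%N) => i.
have [ltE nthE] := column_row k _ i.+1 shape_t k_gt0; rewrite -/(Defs.col k t) ltE => k_le.
have [size_le lt_rows] := t_st i.
have [_ ->] := column_row k _ i shape_t k_gt0; last exact: leq_trans size_le.
by rewrite nthE //; apply: lt_rows; rewrite prednK.
Qed.

(** Removing the last box of a row of size 1 leaves an empty row, which has to
    be dropped.  Describing the smaller tableau as a trimmed one treats this case
    together with the others. *)
Definition trim (t : seq (seq nat)) := [seq r <- t | r != [::]].

Lemma trim_id t : [::] \notin t -> trim t = t.
Proof. by move=> t0; apply/all_filterP/allP => r rt; apply: contraNneq t0 => <-. Qed.

Lemma flatten_trim t : flatten (trim t) = flatten t.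
Proof. by rewrite /trim; elim: t => //= -[|a r] t //= ->. Qed.

Lemma trim_map_trim (f : seq nat -> seq nat) t : f [::] = [::] ->
  trim (map f (trim t)) = trim (map f t).
Proof. by move=> f0; rewrite /trim; elim: t => //= -[|a r] t; rewrite ?f0 //= => ->. Qed.

(** The sizes k < 3 of the rows, new rows of size 0 included, to which a box
    may be added. *)
Definition slots (t : seq (seq nat)) : seq nat :=
  [seq k <- iota 0 3 | (k == 0)%N || (k \in shape t)].

(** The lowest row of size [k] is the one row of that size that can be extended.  For
    [k = 0] no row is found, the index is the number of rows and a new row
    is created. *)
Definition grow (k m : nat) (t : seq (seq nat)) : seq (seq nat) :=
  let i := find (fun r => size r == k) t in
  set_nth [::] t i (rcons (row t i) m).

Lemma growE k m t1 a t2 : size a = k -> k \notin shape t1 ->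
  grow k m (t1 ++ a :: t2) = t1 ++ rcons a m :: t2.
Proof.
move=> size_a k_t1; rewrite /grow find_cat.
have -> : has (fun r => size r == k) t1 = false.
  by apply/hasP => -[r rt1 /eqP size_r]; case/mapP: k_t1; exists r.
rewrite /= size_a eqxx addn0 nth_cat ltnn subnn /=.
by elim: t1 {k_t1} => //= s t1 ->.
Qed.

Lemma grow0E m t : [::] \notin t -> grow 0 m t = rcons t [:: m].
Proof.
move=> t0; rewrite /grow hasNfind; last first.
  by apply/hasP => -[r rt /eqP/size0nil r0]; rewrite -r0 rt in t0.
by rewrite nth_default //= set_nthE ltnn subnn /= cats1.
Qed.

Lemma mem_slots k t : k \in slots t = (k < 3)%N && ((k == 0)%N || (k \in shape t)).
Proof. by rewrite mem_filter mem_iota andbC. Qed.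

(** The form in which growth is used below: the row [a] receives the box, and for a
    new row [a] is empty and disappears by trimming. *)
Lemma grow_spec k m t : [::] \notin t -> (k == 0)%N || (k \in shape t) ->
  exists t1 a t2, [/\ t = trim (t1 ++ a :: t2), size a = k,
    k \notin shape t1, [::] \notin t1 ++ t2 & grow k m t = t1 ++ rcons a m :: t2].
Proof.
move=> t0 /orP[/eqP->|k_t].
  exists t, [::], [::]; split=> //; last by rewrite grow0E // cats1.
  - by rewrite /trim filter_cat /= cats0 -/(trim t) trim_id.
  - by apply: contra t0 => /mapP[r rt /esym/size0nil <-].
  - by rewrite cats0.
have t_has : has (fun r => size r == k) t.
  by case/mapP: k_t => r rt ->; apply/hasP; exists r.
have def_t := cat_take_drop (find (fun r => size r == k) t) t.
have lt_i : (find (fun r => size r == k) t < size t)%N by rewrite -has_find.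
rewrite (drop_nth [::] lt_i) in def_t.
set t1 := take _ _ in def_t; set t2 := drop _ _ in def_t.
have size_a := eqP (nth_find [::] t_has); set a := row _ _ in size_a def_t.
have k_t1 : k \notin shape t1.
  apply/mapP => -[r /(nthP [::])[j]]; rewrite size_take lt_i => lt_j <- size_r.
  have := before_find [::] lt_j; rewrite size_r -(nth_take _ lt_j) ?eqxx //.
exists t1, a, t2; split=> //; first by rewrite def_t trim_id.
  by apply: contra t0; rewrite -[in X in _ -> X]def_t !mem_cat inE => /orP[] ->; rewrite ?orbT.
by rewrite -[in LHS]def_t growE.
Qed.

Lemma syt_le n t : is_syt n t -> forall x, x \in flatten t -> (0 < x <= n)%N.
Proof. by case/is_sytP => t_perm _ _ _ x; rewrite (perm_mem t_perm) mem_iota; lia. Qed.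

Lemma syt_nil n t : is_syt n t -> [::] \notin t.
Proof. by case/is_sytP. Qed.

Lemma restrict_trim i t :
  restrict i (trim t) = restrict i t.
Proof. exact: trim_map_trim. Qed.

Lemma restrict_grow i k m t : [::] \notin t -> (k == 0)%N || (k \in shape t) ->
  (i < m)%N -> restrict i (grow k m t) = restrict i t.
Proof.
move=> t0 k_t lt_im; have [t1 [a [t2 [def_t _ _ _ ->]]]] := grow_spec k m t t0 k_t.
rewrite {1}def_t.
rewrite restrict_trim /restrict !map_cat /= filter_rcons.
by rewrite leqNgt lt_im.
Qed.

Lemma restrict_syt n t : is_syt n t -> restrict n t = t.
Proof.
move=> t_syt; rewrite -[RHS](trim_id t (syt_nil _ _ t_syt)); congr trim.
rewrite -[RHS]map_id; apply/eq_in_map => r rt; apply/all_filterP/allP => x xr.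
have /(syt_le _ _ t_syt) : x \in flatten t by apply/flattenP; exists r.
by case/andP.
Qed.

Lemma col_index_trim i t : col_index i (trim t) = col_index i t.
Proof.
rewrite /col_index /trim -filter_predI; congr (head _ (map _ _)).
by apply: eq_filter => -[|a r] //=; rewrite ?andbT.
Qed.

Lemma col_index_grow i k m t : [::] \notin t -> (k == 0)%N || (k \in shape t) ->
  (i < m)%N -> col_index i (grow k m t) = col_index i t.
Proof.
move=> t0 k_t lt_im; have [t1 [a [t2 [def_t _ _ _ ->]]]] := grow_spec k m t t0 k_t.
rewrite {1}def_t.
rewrite col_index_trim /col_index !filter_cat /= mem_rcons inE ltn_eqF //=.
case: ifP => // ia; rewrite !map_cat /= -cats1 index_cat ia //.
Qed.

Lemma box_sorting_index_grow i k m t : [::] \notin t ->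
  (k == 0)%N || (k \in shape t) -> (i < m)%N ->
  box_sorting_index i (grow k m t) = box_sorting_index i t.
Proof. by move=> *; rewrite /box_sorting_index restrict_grow // col_index_grow. Qed.

Lemma col_index_new k m t : [::] \notin t -> (k == 0)%N || (k \in shape t) ->
  m \notin flatten t -> col_index m (grow k m t) = k.+1.
Proof.
move=> t0 k_t; have [t1 [a [t2 [def_t <- _ _ ->]]]] := grow_spec k m t t0 k_t.
rewrite {1}def_t.
rewrite flatten_trim flatten_cat /= !mem_cat !negb_or => /and3P[m1 ma m2].
rewrite /col_index filter_cat /= mem_rcons mem_head.
rewrite (_ : [seq r <- t1 | m \in r] = [::]); last first.
  apply/eqP; rewrite -(negbK (_ == _)) -has_filter; apply/hasP => -[r rt mr].
  by case/flattenP: m1; exists r.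
by rewrite /= -cats1 index_cat (negbTE ma) /= eqxx addn0.
Qed.

(** The sizes of the rows change by replacing one [k] by [k.+1].  Rows of size 0 are
    not counted, which is what allows [k = 0]. *)
Lemma count_shape_grow (P : pred nat) k m t : [::] \notin t ->
  (k == 0)%N || (k \in shape t) -> ~~ P 0%N ->
  (count P (shape (grow k m t)) + P k = count P (shape t) + P k.+1)%N.
Proof.
move=> t0 k_t P0; have [t1 [a [t2 [def_t size_a _ _ ->]]]] := grow_spec k m t t0 k_t.
rewrite {1}def_t.
have -> : count P (shape (trim (t1 ++ a :: t2))) = count P (shape (t1 ++ a :: t2)).
  rewrite /trim; elim: (t1 ++ _) => //= -[|x r] u /= ->//.
  by rewrite (negbTE P0).
rewrite /shape !map_cat !count_cat /= size_rcons size_a; lia.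
Qed.

Lemma size_grow k m t : [::] \notin t -> (k == 0)%N || (k \in shape t) ->
  size (grow k m t) = (size t + (k == 0)%N)%N.
Proof.
move=> t0 k_t; have [t1 [a [t2 [def_t size_a _ t12 ->]]]] := grow_spec k m t t0 k_t.
rewrite {1}def_t.
move: t12; rewrite mem_cat negb_or => /andP[t1_nil t2_nil].
rewrite /trim filter_cat /= -/(trim t1) -/(trim t2) !size_cat -size_eq0 size_a (trim_id t1) //.
by case: (k == 0)%N; rewrite /= trim_id //; lia.
Qed.

Lemma flatten_grow k m t : [::] \notin t -> (k == 0)%N || (k \in shape t) ->
  perm_eq (flatten (grow k m t)) (rcons (flatten t) m).
Proof.
move=> t0 k_t; have [t1 [a [t2 [def_t _ _ _ ->]]]] := grow_spec k m t t0 k_t.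
rewrite {1}def_t.
rewrite flatten_trim !flatten_cat /=; apply/permP => P.
by rewrite -!cats1 !count_cat /=; lia.
Qed.

Lemma stacked_size t i : stacked t -> (size (row t i) <= size (row t 0))%N.
Proof. by move=> t_st; elim: i => // i; apply: leq_trans; case: (t_st i). Qed.

(** The row below the lowest row of size [k] is strictly longer, so that the sizes of
    the rows still do not increase after the growth. *)
Lemma slots_spec k t : stacked t -> (k == 0)%N || (k \in shape t) ->
  let i := find (fun r => size r == k) t in
  size (row t i) = k /\ forall j, (j.+1 = i -> k < size (row t j))%N.
Proof.
move=> t_st k_t i.
have size_i : size (row t i) = k.
  rewrite /i; case: (boolP (has (fun r => size r == k) t)) => [/(nth_find [::])/eqP//|no_k].
  rewrite hasNfind // nth_default //; apply/esym/eqP.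
  case/orP: k_t => // /mapP[r rt def_k]; case/hasP: no_k.
  by exists r; rewrite ?def_k.
split=> // j ji; rewrite ltn_neqAle; apply/andP; split; last first.
  by rewrite -size_i -ji; case: (t_st j).
have lt_ji : (j < i)%N by rewrite -ji.
by have := before_find [::] lt_ji; rewrite eq_sym => ->.
Qed.

Lemma stacked_grow k m t : stacked t -> (k == 0)%N || (k \in shape t) ->
  {in flatten t, forall x, x < m}%N -> stacked (grow k m t).
Proof.
move=> t_st k_t lt_m; have [] := slots_spec k t t_st k_t; rewrite /grow.
set i := find _ t => size_i size_prev j; rewrite !nth_set_nth /=.
have [size_le lt_rows] := t_st j.
have [ji|ji] := eqVneq j.+1 i; last first.
  case: eqVneq => // eq_ji; rewrite -eq_ji size_rcons.
  split=> [|c lt_c]; first exact: leqW.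
  by rewrite nth_rcons (leq_trans lt_c size_le); apply: lt_rows.
have -> : (j == i) = false by rewrite -ji ltn_eqF.
rewrite size_rcons size_i.
have k_lt := size_prev j ji; split=> // c; rewrite ltnS leq_eqVlt nth_rcons size_i.
case: ltngtP => //= [lt_c _|-> _]; last exact/lt_m/mem_flatten_row.
by rewrite -ji; apply: lt_rows; rewrite ji size_i.
Qed.

Lemma syt_grow k n t : is_syt n t -> (k == 0)%N || (k \in shape t) ->
  is_syt n.+1 (grow k n.+1 t).
Proof.
move=> t_syt k_t; have t_le := syt_le _ _ t_syt.
have lt_m : {in flatten t, forall x, x < n.+1}%N by move=> x /t_le; lia.
case/is_sytP: (t_syt) => t_perm t0 t_rows t_st; apply/is_sytP; split.
- rewrite (permPl (flatten_grow _ _ _ t0 k_t)) iota1S.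
  by rewrite -cats1 perm_cat2r.
- have [t1 [a [t2 [_ _ _ t12 ->]]]] := grow_spec k n.+1 t t0 k_t.
  by move: t12; rewrite !mem_cat inE; case: a.
- have [t1 [a [t2 [def_t _ _ _ ->]]]] := grow_spec k n.+1 t t0 k_t.
  have rows12 r : r \in t1 ++ a :: t2 -> sorted ltn r.
    have [->//|r0 r12] := eqVneq r [::].
    by apply: (allP t_rows); rewrite def_t mem_filter r0.
  apply/allP => r; rewrite mem_cat inE => r_in.
  have [->|r_a] := eqVneq r (rcons a n.+1); last first.
    apply: rows12; move: r_in.
    by rewrite (negbTE r_a) /= mem_cat inE => /orP[] ->; rewrite ?orbT.
  apply: sorted_rcons_ltn; last by apply: rows12; rewrite mem_cat mem_head orbT.
  move=> x xa; apply: lt_m; rewrite def_t flatten_trim flatten_cat /= !mem_cat xa.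
  by rewrite orbT.
- exact: stacked_grow.
Qed.

(** The largest entry ends its row and no row above reaches as far, so that it can
    be removed; the row it leaves is then the lowest one of its size. *)
Lemma syt_last n t' : is_syt n.+1 t' ->
  exists t k, [/\ is_syt n t, (k == 0)%N || (k \in shape t) & t' = grow k n.+1 t].
Proof.
move=> t'_syt; have t'_le := syt_le _ _ t'_syt.
case/is_sytP: t'_syt => t_perm t0 t_rows t_st; set m := n.+1.
have m_t' : m \in flatten t' by rewrite (perm_mem t_perm) mem_iota /m; lia.
case/flattenP: m_t' => r /mem_split[t1 [t2 def_t']] /mem_split[a [b def_r]].
have def_b : b = [::].
  case: b def_r => // y b def_r.
  have : sorted ltn r by apply: (allP t_rows); rewrite def_t' mem_cat mem_head orbT.
  rewrite def_r => /cat_sorted2[_] /= /andP[lt_my _].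
  have /t'_le : y \in flatten t'.
    by rewrite def_t' flatten_cat /= def_r !mem_cat !inE eqxx !orbT.
  by rewrite -/m; lia.
have {def_b}def_r : r = rcons a m by rewrite def_r def_b cats1.
have row_t1 : row t' (size t1) = rcons a m by rewrite def_t' nth_cat ltnn subnn /= def_r.
have size_next : (size (row t' (size t1).+1) <= size a)%N.
  rewrite leqNgt; apply/negP => lt_next.
  have [_ /(_ _ lt_next)] := t_st (size t1).
  rewrite row_t1 nth_rcons ltnn eqxx ltnNge.
  by have /t'_le/andP[_ ->] := mem_flatten_row _ _ _ lt_next.
(* [u] is [t'] without its largest entry; it ends with an empty row exactly when
   that entry was alone in its row. *)
set u := t1 ++ a :: t2.
have rowE j : row u j = if j == size t1 then a else row t' j.
  rewrite /u def_t' !nth_cat; case: ltngtP => // [lt_j|->]; last by rewrite subnn.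
  by rewrite -(subnSK lt_j).
have u_st : stacked u.
  move=> j; rewrite !rowE; have [size_le lt_rows] := t_st j.
  case: (eqVneq j.+1 (size t1)) => [ji|_].
    rewrite -ji (ltn_eqF (ltnSn j)); move: size_le lt_rows; rewrite ji row_t1 size_rcons.
    move=> size_le lt_rows; split=> [|c lt_c]; first exact: ltnW.
    by have := lt_rows c (leqW lt_c); rewrite nth_rcons lt_c.
  case: (eqVneq j (size t1)) => [ji|_]; last by [].
  move: size_le lt_rows; rewrite ji row_t1 => _ lt_rows; split=> // c lt_c.
  by have := lt_rows c lt_c; rewrite nth_rcons (leq_trans lt_c size_next).
have u_perm : perm_eq (flatten u) (iota 1 n).
  rewrite iota1S in t_perm.
  rewrite -(perm_cat2r [:: m]) -(permPr t_perm) def_t' /u !flatten_cat /= def_r.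
  by apply/permP => P; rewrite -cats1 !count_cat /=; lia.
have u_rows : all (sorted ltn) u.
  apply/allP => s; rewrite mem_cat inE => s_in.
  have [->|s_a] := eqVneq s a; last first.
    apply: (allP t_rows); move: s_in.
    by rewrite def_t' (negbTE s_a) /= mem_cat inE => /orP[] ->; rewrite ?orbT.
  have : sorted ltn r by apply: (allP t_rows); rewrite def_t' mem_cat mem_head orbT.
  by rewrite def_r -cats1 => /cat_sorted2[].
have t12 : [::] \notin t1 ++ t2.
  by apply: contra t0; rewrite def_t' !mem_cat inE => /orP[] ->; rewrite ?orbT.
have k_t1 : size a \notin shape t1.
  apply/mapP => -[s /(nthP [::])[j lt_j <-]] size_j.
  have : (size (row t' (size t1)) <= size (row t' j))%N.
    rewrite -(subnKC (ltnW lt_j)); elim: (_ - _)%N => [|d IH]; first by rewrite addn0.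
    by rewrite addnS; apply: leq_trans IH; case: (t_st (j + d)%N).
  by rewrite row_t1 size_rcons def_t' nth_cat lt_j -size_j ltnn.
have def_grow : t' = grow (size a) m u by rewrite /u growE // def_t' def_r.
have [a0|a0] := eqVneq a [::]; last first.
  exists u, (size a); split=> //; last by rewrite /shape map_cat mem_cat mem_head !orbT.
  apply/is_sytP; split=> //; rewrite /u mem_cat inE eq_sym (negbTE a0) /=.
  by rewrite mem_cat in t12.
have t20 : t2 = [::].
  move: size_next t12; rewrite def_t' a0 nth_cat ltnNge leqnSn subSnn /=.
  by case: (t2) => // s t3; rewrite leqn0 size_eq0 => /eqP /= ->; rewrite mem_cat mem_head orbT.
have def_u : u = rcons t1 [::] by rewrite /u a0 t20 cats1.
have rowu j : row u j = row t1 j.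
  rewrite def_u nth_rcons; case: ltngtP => // [lt_j|->]; first by rewrite nth_default // ltnW.
  by rewrite nth_default.
rewrite t20 cats0 in t12.
exists t1, 0%N; split=> //; last by rewrite grow0E // def_t' def_r a0 t20 cats1.
apply/is_sytP; split=> //.
- by move: u_perm; rewrite def_u -cats1 flatten_cat /= cats0.
- by move: u_rows; rewrite def_u all_rcons.
by move=> j; rewrite -!rowu; apply: u_st.
Qed.

(** * The box sorting index of a new box *)

Lemma colE k t : Defs.col k t = count (leq k) (shape t).
Proof. by rewrite /Defs.col size_map size_filter count_map. Qed.

Lemma count_leqS k s : count (leq k) s = (count_mem k s + count (leq k.+1) s)%N.
Proof. by elim: s => //= x s ->; case: (ltngtP k x) => /=; lia. Qed.

Lemma col1 t : [::] \notin t -> Defs.col 1 t = size t.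
Proof.
move=> t0; rewrite colE -(size_map size t); apply/eqP; rewrite -all_count.
apply/allP => x /mapP[r rt ->]; rewrite lt0n size_eq0.
by apply: contraNneq t0 => <-.
Qed.

Lemma size_syt n t : is_syt n t -> (size t <= n)%N.
Proof.
case/is_sytP => /perm_size; rewrite size_iota size_flatten => <- t0 _ _.
by rewrite -(col1 t t0) colE; elim: (shape t) => //= x s; case: x => //=; lia.
Qed.

(** For [k > 0], the numbers of boxes in the columns [k] and [k.+1] of the old tableau
    differ by its number of rows of size [k], and the new box adds 1 to column [k.+1]. *)
Lemma box_sorting_index_new k n t : is_syt n t -> (k == 0)%N || (k \in shape t) ->
  box_sorting_index n.+1 (grow k n.+1 t) =
  if k == 0%N then (n.+1 - size t)%N else nrows_of_size k t.
Proof.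
move=> t_syt k_t; have t0 := syt_nil _ _ t_syt.
have m_t : n.+1 \notin flatten t.
  by apply/negP => /(syt_le _ _ t_syt); rewrite ltnn andbF.
have g_syt := syt_grow _ _ _ t_syt k_t.
rewrite /box_sorting_index (restrict_syt _ _ g_syt) col_index_new // eqSS.
case: eqVneq => [k0|k0].
  rewrite col1 ?(syt_nil _ _ g_syt) // size_grow // k0 eqxx /=.
  by have := size_syt _ _ t_syt; lia.
rewrite (negbTE k0) /= in k_t; rewrite /= !colE.
have k_t' : (k == 0)%N || (k \in shape t) by rewrite k_t orbT.
have := count_shape_grow (leq k) k n.+1 t t0 k_t'; rewrite -ltnNge lt0n => /(_ k0).
have := count_shape_grow (leq k.+1) k n.+1 t t0 k_t' isT.
have : (0 < count_mem k (shape t))%N by rewrite -has_count has_pred1.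
rewrite !leqnn leqnSn ltnn /= (count_leqS k (shape t)) /nrows_of_size.
rewrite addn0 => w_gt0 -> /eqP; rewrite eqn_add2r => /eqP ->.
have cancel w c : (0 < w -> w + c - (c + 1) + 1 = w)%N by lia.
exact: cancel.
Qed.

Lemma nrows_of_size_grow i k m t : [::] \notin t -> (k == 0)%N || (k \in shape t) ->
  (0 < i)%N ->
  (nrows_of_size i (grow k m t) + (k == i) = nrows_of_size i t + (k.+1 == i))%N.
Proof. by move=> t0 k_t i0; apply: count_shape_grow; rewrite //= neq_ltn i0. Qed.

(** * Derivatives of the terms of tableaux *)

Definition tableau_term (n : nat) (t : seq (seq nat)) : {mpoly int[3]} :=
  (\prod_(1 <= i < n.+1) box_sorting_index i t)%N%:R
    * c1 ^+ nrows_of_size 1 t * c2 ^+ nrows_of_size 2 t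
    * 6%:R ^+ nrows_of_size 3 t * e3 ^+ (n + 1 - nrows t)%N.

(** The subtractions are not truncated: when [k] is the size of a row there is a row
    of size [k] to be used up. *)
Lemma tableau_term_grow k n t : is_syt n t -> (k == 0)%N || (k \in shape t) ->
  tableau_term n.+1 (grow k n.+1 t) =
  (\prod_(1 <= i < n.+1) box_sorting_index i t)%N%:R
    * (if k == 0%N then (n.+1 - size t)%N else nrows_of_size k t)%:R
    * c1 ^+ (nrows_of_size 1 t + (k == 0) - (k == 1))%N
    * c2 ^+ (nrows_of_size 2 t + (k == 1) - (k == 2))%N
    * 6%:R ^+ (nrows_of_size 3 t + (k == 2) - (k == 3))%N
    * e3 ^+ (n + 2 - (size t + (k == 0)))%N.
Proof.
move=> t_syt k_t; have t0 := syt_nil _ _ t_syt.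
have nrowsE i : (0 < i)%N -> nrows_of_size i (grow k n.+1 t) =
    (nrows_of_size i t + (k.+1 == i) - (k == i))%N.
  by move=> i0; have := nrows_of_size_grow i k n.+1 t t0 k_t i0; lia.
have old_boxes : (\prod_(1 <= i < n.+1) box_sorting_index i (grow k n.+1 t) =
    \prod_(1 <= i < n.+1) box_sorting_index i t)%N.
  by apply: eq_big_nat => i /andP[_ lt_i]; apply: box_sorting_index_grow.
rewrite /tableau_term big_nat_recr // old_boxes box_sorting_index_new // natrM.
rewrite !nrowsE // !eqSS /nrows size_grow //.
by have -> : (n.+1 + 1 = n + 2)%N by rewrite addn1 addn2.
Qed.

(** The three summands of the Leibniz rule match the three slots.  For a slot [k > 0]
    that is absent from the shape, the coefficient, which is the number of rows of
    size [k], is zero. *)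
Lemma D_tableau_term n t : is_syt n t ->
  D (tableau_term n t) = \sum_(k <- slots t) tableau_term n.+1 (grow k n.+1 t).
Proof.
move=> t_syt; have t_size := size_syt _ _ t_syt.
rewrite /slots big_filter big_mkcond /=.
rewrite !big_cons big_nil /= tableau_term_grow //= addr0.
have step_k k : (0 < k)%N ->
    (if k \in shape t then tableau_term n.+1 (grow k n.+1 t) else 0) =
    (\prod_(1 <= i < n.+1) box_sorting_index i t)%N%:R
    * (nrows_of_size k t)%:R
    * c1 ^+ (nrows_of_size 1 t - (k == 1))%N
    * c2 ^+ (nrows_of_size 2 t + (k == 1) - (k == 2))%N
    * 6%:R ^+ (nrows_of_size 3 t + (k == 2) - (k == 3))%N
    * e3 ^+ (n + 2 - size t)%N.
  move=> k0; case: ifP => [k_t|/negbT/count_memPn k_t].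
    by rewrite tableau_term_grow ?k_t ?orbT // (gtn_eqF k0) !addn0.
  by rewrite /nrows_of_size k_t; ring.
rewrite !step_k //= /tableau_term /nrows.
move: (nrows_of_size 1 t) (nrows_of_size 2 t) (nrows_of_size 3 t) => w1 w2 w3.
move: (\prod_(_ <= i < _) _)%N => P.
rewrite !addn0 !subn0 !addn1 !subn1.
have -> : (n + 2 - (size t).+1)%N = (n - size t).+1 by lia.
have -> : (n.+1 - size t)%N = (n - size t).+1 by lia.
have -> : (n + 2 - size t)%N = (n - size t).+2 by lia.
move: (n - size t)%N => e.
rewrite !DM !D_nat !D_exp !D_nat D_c1 D_c2 D_e3 /= !exprS.
by ring.
Qed.

(** * Enumeration of the tableaux with at most three columns *)

Fixpoint tableaux3 (n : nat) : seq (seq (seq nat)) :=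
  if n is m.+1 then [seq grow k m.+1 t | t <- tableaux3 m, k <- slots t]
  else [:: [::]].

(** The bound on the columns is inherited by the smaller tableau and restricts the slot:
    a row of size [k] that grows gets [k.+1 <= 3] boxes. *)
Lemma mem_tableaux3 n t :
  (t \in tableaux3 n) = is_syt n t && (head 0%N (shape t) <= 3)%N.
Proof.
elim: n t => [|n IH] t.
  rewrite /= inE; apply/eqP/andP => [->|[/is_sytP[/perm_size + t0 _ _] _]].
    by split=> //; apply/is_sytP; split=> // i; rewrite nth_nil.
  case: t t0 => // -[|a r] t //; by rewrite inE eqxx.
have head_row s : head 0%N (shape s) = size (row s 0) by case: s.
apply/allpairsPdep/andP => [[s [k [s_tab k_s ->]]]|[t_syt]].
  move: s_tab k_s; rewrite IH mem_slots => /andP[s_syt s_le] /andP[k_lt k_s].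
  split; first exact: syt_grow.
  move: s_le; rewrite !head_row /grow nth_set_nth /=; case: eqP => // i0 _.
  have [_ _ _ s_st] := is_sytP _ _ s_syt.
  by rewrite size_rcons (slots_spec k s s_st k_s).1.
have [s [k [s_syt k_s def_t]]] := syt_last n t t_syt.
have [_ _ _ t_st] := is_sytP _ _ t_syt; have [_ _ _ s_st] := is_sytP _ _ s_syt.
rewrite head_row => t_le; exists s, k; split=> //.
  rewrite IH s_syt head_row /=; apply: leq_trans t_le.
  by rewrite def_t /grow nth_set_nth /=; case: eqP => // <-; rewrite size_rcons.
rewrite mem_slots k_s andbT; apply: leq_trans t_le.
apply: leq_trans (stacked_size t (find (fun r => size r == k) s) t_st).
by rewrite def_t /grow nth_set_nth /= eqxx size_rcons (slots_spec k s s_st k_s).1.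
Qed.

(** A tableau determines the one that it grew from, by deletion of the largest entry, and
    the slot, by the column of that entry. *)
Lemma uniq_tableaux3 n : uniq (tableaux3 n).
Proof.
elim: n => // n IH.
apply: (allpairs_uniq_retract _ _ _ (fun t k => grow k n.+1 t)
          (fun t => (restrict n t, (col_index n.+1 t).-1)) _ slots) => //.
  by move=> t _; rewrite filter_uniq ?iota_uniq.
move=> t; rewrite mem_tableaux3 => /andP[t_syt _] k; rewrite mem_slots => /andP[_ k_t].
have t0 := syt_nil _ _ t_syt.
rewrite restrict_grow // restrict_syt // col_index_new //.
by apply/negP => /(syt_le _ _ t_syt); rewrite ltnn andbF.
Qed.

Lemma sum_tableaux3 n :
  \sum_(t <- tableaux3 n) tableau_term n t = iter n D e3.
Proof.
elim: n => [|n IH].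
  by rewrite big_seq1 /tableau_term big_geq // !expr0 expr1 !mul1r.
rewrite iterS -IH D_sum.
rewrite -[tableaux3 _]/[seq grow k n.+1 t | t <- tableaux3 n, k <- slots t].
rewrite big_allpairs_dep.
apply/esym/eq_big_seq => t; rewrite mem_tableaux3 => /andP[t_syt _].
exact: D_tableau_term.
Qed.

Lemma rows_inj n : injective (@rows n).
Proof.
move=> T U /inj_map eqTU; apply/val_inj/eqTU => r s.
by move=> /(inj_map val_inj)/val_inj.
Qed.

Lemma rows_onto n t : (size t <= n)%N -> all (fun r => size r <= n)%N t ->
  {in flatten t, forall x, x <= n}%N -> exists T : tableau n, rows T = t.
Proof.
move=> t_size r_size t_le.
pose T : tableau n := insub_bseq n [seq insub_bseq n [seq inord e | e <- r] | r <- t].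
have val_insub (X : Type) (s : seq X) : (size s <= n)%N -> val (insub_bseq n s) = s.
  by move=> s_le; rewrite /insub_bseq insubdK.
exists T; rewrite /rows val_insub ?size_map // -map_comp.
rewrite -[RHS]map_id; apply/eq_in_map => r rt /=.
rewrite val_insub ?size_map; last exact: (allP r_size).
rewrite -map_comp -[RHS]map_id; apply/eq_in_map => x xr /=.
by rewrite inordK // ltnS t_le //; apply/flattenP; exists r.
Qed.

Lemma perm_rows_SYT_cols n :
  perm_eq [seq rows T | T <- enum (SYT_cols n 3)] (tableaux3 n).
Proof.
apply: uniq_perm; [|exact: uniq_tableaux3|].
  by rewrite map_inj_uniq ?enum_uniq //; apply: rows_inj.
move=> t; rewrite mem_tableaux3; apply/mapP/andP => [[T]|[t_syt t_le]].
  by rewrite mem_enum !inE => /andP[T_syt T_le] ->.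
have [T def_T] : exists T : tableau n, rows T = t.
  have t_mem := syt_le _ _ t_syt.
  apply: rows_onto; [exact: size_syt| |by move=> x /t_mem/andP[]].
  have [/perm_size t_size _ _ _] := is_sytP _ _ t_syt.
  apply/allP => r rt; rewrite -(size_iota 1 n) -t_size.
  by have [t1 [t2 ->]] := mem_split _ _ _ rt; rewrite flatten_cat !size_cat /=; lia.
by exists T; rewrite // mem_enum !inE def_T t_syt.
Qed.

Theorem theorem40 (n : nat) (hn : (1 <= n)%N) :
  eulerian2 n.+1 =
  \sum_(T in SYT_cols n 3)
    (\prod_(1 <= i < n.+1) box_sorting_index i (rows T))%N%:R
    * (px * py + py * pz + px * pz) ^+ nrows_of_size 1 (rows T)
    * (2%:R * px + 2%:R * py + 2%:R * pz) ^+ nrows_of_size 2 (rows T)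
    * 6%:R ^+ nrows_of_size 3 (rows T)
    * (px * py * pz) ^+ (n + 1 - nrows (rows T))%N.
Proof.
rewrite eulerian2E -sum_tableaux3 -(perm_big _ (perm_rows_SYT_cols n)) /=.
by rewrite big_map big_enum.
Qed.
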